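(* Let $K$ be a field, let $s\ge 2$, let $G=H(a_1,\ldots,a_s)$ with $a_i\geq 1$ for all $i=1,\ldots,s$, and let $k\in\{1,\ldots,\nu(G)\}$. Then: (a) $\nu(G)=s$; (b) $G$ is cochordal; (c) the following statements are equivalent: (i) $g_{I(G)}(k)=0$; (ii) $\lfloor s/2\rfloor+1\leq k\leq s$.
   Context: $H(a_1,\ldots,a_s)$ denotes the multiple whiskered complete graph obtained from the complete graph $K_s$ on vertex set $\{1,\ldots,s\}$ by attaching, for each $i$, $a_i\ge 0$ whiskers to the vertex $i$ (that is, adding $a_i$ new vertices of degree one, each adjacent only to $i$). For a finite simple graph $G$ on $n$ vertices, identify the vertices with the variables of a polynomial ring $S=K[x_1,\ldots,x_n]$. The edge ideal $I(G)\subset S$ is generated by all $x_ix_j$ with $\{i,j\}$ an edge of $G$. A $k$-matching is a set of $k$ pairwise disjoint edges, and $\nu(G)$ is the maximum size of a matching of $G$. The $k$-th squarefree power $I(G)^{[k]}$ is the ideal generated by the squarefree monomials $x_{i_1}x_{j_1}\cdots x_{i_k}x_{j_k}$ where $\{i_1,j_1\},\ldots,\{i_k,j_k\}$ is a $k$-matching of $G$. For $1\le k\le \nu(G)$, $g_{I(G)}(k)=\operatorname{depth}(S/I(G)^{[k]})-(2k-1)$. A graph is cochordal if its complementary graph is chordal (has no induced cycle of length greater than $3$). *)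

(* Defs.v *)
From Stdlib Require Import ClassicalEpsilon.
From mathcomp Require Import all_boot all_order all_algebra.
From mathcomp Require Import mpoly.

Set Implicit Arguments.
Unset Strict Implicit.
Unset Printing Implicit Defensive.

Import Order.TTheory GRing.Theory Num.Theory.
Local Open Scope ring_scope.

Record sgraph := SGraph {
  vertex :> finType;
  adj : rel vertex;
  adj_sym : ssrbool.symmetric adj;
  adj_irr : irreflexive adj }.

Section Graphs.
Variable G : sgraph.
Implicit Types (M : {set {set G}}) (c : seq G).

Definition edges : {set {set G}} :=
  [set [set x; y] | x in G, y in G & adj x y].

Definition matching M : bool := (M \subset edges) && trivIset M.

Definition k_matching (k : nat) M : bool := matching M && (#|M| == k).

Definition matching_number : nat := \max_(M | matching M) #|M|.

(* The cyclic order of c is given by path.next, so that the condition says    *)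
(* that the subgraph induced on c is exactly the cycle c.                     *)
Definition induced_cycle c : Prop :=
  [/\ (2 < size c)%N, uniq c &
      {in c &, forall x y, adj x y = (y == next c x) || (x == next c y)}].

Definition chordal : Prop := forall c, induced_cycle c -> (size c <= 3)%N.

Definition cadj : rel G := [rel x y | (x != y) && ~~ adj x y].

Lemma cadj_sym : ssrbool.symmetric cadj.
Proof. by move=> x y; rewrite /cadj /= eq_sym adj_sym. Qed.

Lemma cadj_irr : irreflexive cadj.
Proof. by move=> x; rewrite /cadj /= eqxx. Qed.

Definition complement : sgraph := SGraph cadj_sym cadj_irr.

End Graphs.

Definition cochordal (G : sgraph) : Prop := chordal (complement G).

(* inl i is the vertex i of K_s; inr w is a whisker vertex, attached to tag w *)
Section Whiskered.
Variables (s : nat) (a : 'I_s -> nat).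

Definition whiskered_vertex : finType := ('I_s + {i : 'I_s & 'I_(a i)})%type.

Definition whiskered_adj : rel whiskered_vertex := fun u v =>
  match u, v with
  | inl i, inl j => i != j
  | inl i, inr w => tag w == i
  | inr w, inl i => tag w == i
  | inr _, inr _ => false
  end.

Lemma whiskered_adj_sym : ssrbool.symmetric whiskered_adj.
Proof. by case=> [i|w] [j|w'] //=; rewrite eq_sym. Qed.

Lemma whiskered_adj_irr : irreflexive whiskered_adj.
Proof. by case=> [i|w] //=; rewrite eqxx. Qed.

Definition whiskered_complete : sgraph :=
  SGraph whiskered_adj_sym whiskered_adj_irr.

End Whiskered.

Section Depth.
Variables (K : fieldType) (n : nat).
Local Notation S := {mpoly K[n]}.
Implicit Types (A I : S -> Prop) (fs : seq S).

Definition ideal_gen A (f : S) : Prop :=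
  exists2 t : seq (S * S), (forall p, p \in t -> A p.2) &
    f = \sum_(p <- t) p.1 * p.2.

Definition ideal_add I fs : S -> Prop :=
  ideal_gen (fun g => I g \/ g \in fs).

(* fs is an (S/I)-regular sequence: fs`_i is a nonzerodivisor on              *)
(* S/(I + (fs`_0, ..., fs`_(i-1))) for all i, and S/(I + (fs)) is nonzero.    *)
Definition regular_seq I fs : Prop :=
  (forall i, (i < size fs)%N -> forall h : S,
     ideal_add I (take i fs) (fs`_i * h) -> ideal_add I (take i fs) h)
  /\ ~ ideal_add I fs 1.

Definition in_max_ideal (f : S) : bool := f@_0%MM == 0.

Definition depth_seq I (d : nat) : Prop :=
  exists fs, [/\ size fs = d, all in_max_ideal fs & regular_seq I fs].

Definition is_depth I (d : nat) : Prop :=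
  depth_seq I d /\ forall r, depth_seq I r -> (r <= d)%N.

(* The depth of S/I with respect to the graded maximal ideal, that is, the    *)
(* maximal length of an (S/I)-regular sequence of polynomials without         *)
(* constant term. For a proper ideal I these lengths are at most n, so the    *)
(* maximum exists; the value is unspecified if I is the unit ideal.           *)
Definition depth I : nat := epsilon (inhabits 0%N) (is_depth I).

End Depth.

Section SquarefreePowers.
Variables (K : fieldType) (G : sgraph).

Definition var (v : G) : {mpoly K[#|G|]} := 'X_(enum_rank v).

Definition matching_monomial (M : {set {set G}}) : {mpoly K[#|G|]} :=
  \prod_(e in M) \prod_(v in e) var v.

Definition squarefree_power (k : nat) : {mpoly K[#|G|]} -> Prop :=
  ideal_gen (fun f => exists2 M, k_matching k M & f = matching_monomial M).

Definition normalized_depth (k : nat) : int :=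
  (depth (squarefree_power k))%:Z - (2 * k%:Z - 1).

End SquarefreePowers.

(* Main.v *)
Require Import Defs.
From Stdlib Require Import FunctionalExtensionality PropExtensionality.
From Stdlib Require Import ClassicalEpsilon.
From mathcomp Require Import all_boot all_order all_algebra.
From mathcomp Require Import mpoly.
From mathcomp Require Import ring zify.

(** Write I for the k-th squarefree power of the edge ideal. A monomial lies in
    I exactly when the subgraph induced on its support has a k-matching
    (squarefree_powerE), so I is governed by an upward closed family of vertex
    sets, all of size at least 2k.

    Every hub i of the whiskered graph can be matched to one of its whiskers,
    and every edge meets a hub; this gives the matching number s. The complement
    is a split graph (hubs independent, leaves a clique), and split graphs are
    chordal.

    Regular sequences are produced by the elementary symmetric polynomials
    e_r, ..., e_1, a choice that works over every field. This sequence is regular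
    modulo any ideal generated by variables that leaves at least r of them
    (weakly_regular_coordinate). For a variable x the sequence
    0 -> S/(J:x) -> S/J -> S/(J+x) -> 0 transfers regularity of a fixed sequence
    from the ends to the middle (weakly_regular_split). Starting from I and
    repeatedly splitting along variables, one ends in ideals generated by
    variables; the sequence is regular on S/I as soon as no coordinate subspace
    met at the end has dimension below r. A set of vertices with a k-matching
    has at least 2k elements and the last split removes one vertex from such
    a set, so r = 2k-1 always works (depth_seq_degree). When 2k <= s, split along
    the hubs first. If at least 2k hubs are inverted the ideal has become the unit
    ideal; otherwise some hub has been killed, its whiskers take part in no
    edge, and one of them can be carried along as an additional free variable.
    So r = 2k works (depth_seq_few_edges).

    The upper bound on depth uses the Koszul complex of the variables: if S/I
    has a regular sequence of length r, then its Koszul cohomology vanishes in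
    degrees below r (weakly_regular_coboundary). When s < 2k, take as blocks the
    s single hubs and, for 2k-1-s of the hubs, the set of all whiskers at that hub;
    let D_b be the sum of x_v e_v over a block b, and let c be the product of the
    D_b over these blocks, a cochain of degree 2k-1. Its Koszul differential is the
    sum of the D_b c over the remaining whisker sets b; their coefficients are
    signed sums of products of all hubs with one whisker at each of 2k-s hubs, and
    such a product lies in I. On the other hand the differential of c has a
    coefficient of degree exactly 2k, whereas the differential of a cochain with
    values in I has coefficients in degrees above 2k; hence c is not a coboundary
    modulo I and no regular sequence is longer than 2k-1
    (depth_seq_bound_many_edges). The top Koszul class gives in the same way the
    bound by the number of variables, which makes the maximum that defines depth
    exist.

    Thus depth S/I = 2k-1 when s < 2k <= 2s, and depth S/I >= 2k when 2k <= s. *)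

Set Implicit Arguments.
Unset Strict Implicit.
Unset Printing Implicit Defensive.

Import GRing.Theory.
Local Open Scope ring_scope.

(** * Ideals and weakly regular sequences *)

Section Ideals.
Variable R : comNzRingType.
Implicit Types (J : R -> Prop) (f g h x : R) (fs : seq R).

Definition is_ideal J : Prop :=
  [/\ J 0, forall a b, J a -> J b -> J (a + b) & forall c a, J a -> J (c * a)].

(** The ideal J + (f). *)
Definition add_gen J f : R -> Prop := fun h => exists a, J (h - a * f).

Definition colon J x : R -> Prop := fun h => J (x * h).

Definition nonzerodivisor J f : Prop := forall h, J (f * h) -> J h.

(** Regular sequences on R/J, without the condition that R/(J + (fs)) is nonzero.
    Dropping this condition makes the notion hold for the zero module, which
    occurs as an end of the short exact sequences used below. *)
Fixpoint weakly_regular J fs : Prop :=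
  if fs is f :: fs' then nonzerodivisor J f /\ weakly_regular (add_gen J f) fs'
  else True.

Lemma predicate_ext J J' : (forall h, J h <-> J' h) -> J = J'.
Proof.
by move=> e; apply: functional_extensionality => h; apply: propositional_extensionality.
Qed.

Section IdealTheory.
Variable J : R -> Prop.
Hypothesis idJ : is_ideal J.

Lemma ideal0 : J 0. Proof. by case: idJ. Qed.
Lemma idealD a b : J a -> J b -> J (a + b). Proof. by case: idJ => _ + _; apply. Qed.
Lemma idealM c a : J a -> J (c * a). Proof. by case: idJ => _ _; apply. Qed.
Lemma idealMr c a : J a -> J (a * c). Proof. by rewrite mulrC; apply: idealM. Qed.
Lemma idealN a : J a -> J (- a). Proof. by rewrite -mulN1r; apply: idealM. Qed.
Lemma idealB a b : J a -> J b -> J (a - b).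
Proof. by move=> Ja /idealN; apply: idealD. Qed.
Lemma ideal_sum (I : Type) (r : seq I) (P : pred I) (F : I -> R) :
  (forall i, P i -> J (F i)) -> J (\sum_(i <- r | P i) F i).
Proof. by move=> JF; apply: (big_ind J) => //; [apply: ideal0 | apply: idealD]. Qed.

Lemma add_gen_ideal f : is_ideal (add_gen J f).
Proof.
split=> [|a b [a' Ja] [b' Jb]|c a [a' Ja]].
- by exists 0; rewrite mul0r subr0; apply: ideal0.
- exists (a' + b').
  by have -> : a + b - (a' + b') * f = (a - a' * f) + (b - b' * f) by [ring];
     apply: idealD.
- exists (c * a').
  by have -> : c * a - c * a' * f = c * (a - a' * f) by [ring]; apply: idealM.
Qed.

Lemma colon_ideal x : is_ideal (colon J x).
Proof.
split=> [|a b Ja Jb|c a Ja]; rewrite /colon.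
- by rewrite mulr0; apply: ideal0.
- by rewrite mulrDr; apply: idealD.
- by rewrite mulrCA; apply: idealM.
Qed.

Lemma add_gen_sub f h : J h -> add_gen J f h.
Proof. by move=> Jh; exists 0; rewrite mul0r subr0. Qed.

Lemma add_gen_mem f a : add_gen J f (a * f).
Proof. by exists a; rewrite subrr; apply: ideal0. Qed.

End IdealTheory.

Lemma add_genC J f g : add_gen (add_gen J f) g = add_gen (add_gen J g) f.
Proof.
apply: predicate_ext => h; split=> -[a [b Jh]]; exists b; exists a.
  by rewrite -addrA [- _ - _]addrC addrA.
by rewrite -addrA [- _ - _]addrC addrA.
Qed.

Lemma weakly_regular_full J fs : (forall h, J h) -> weakly_regular J fs.
Proof.
elim: fs J => [|f fs IH] J Jh //=; split=> //; apply: IH => h.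
by exists 0; apply: Jh.
Qed.

(** Transfer along 0 -> R/(J:x) -> R/J -> R/(J+x) -> 0. Regularity of f on
    R/(J+x) is what makes the sequence stay exact modulo f, that is,
    ((J+f):x) = (J:x)+f, so that one can proceed along the sequence. *)
Lemma weakly_regular_split J x fs : is_ideal J ->
  weakly_regular (colon J x) fs -> weakly_regular (add_gen J x) fs ->
  weakly_regular J fs.
Proof.
elim: fs J => [|f fs IH] J idJ //= [nzc regc] [nza rega]; split.
  move=> h Jfh; have [|a Ja] := nza h; first exact: add_gen_sub.
  suff Jxa : J (x * a).
    by rewrite -(subrK (a * x) h); apply: idealD; rewrite // mulrC.
  apply: nzc; rewrite /colon.
  have -> : x * (f * a) = f * h - f * (h - a * x) by ring.
  by apply: idealB; rewrite //; apply: idealM.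
apply: IH; first exact: add_gen_ideal.
  suff <- : add_gen (colon J x) f = colon (add_gen J f) x by [].
  apply: predicate_ext => h; split=> [[g Jg]|[g Jg]].
    by exists (x * g); rewrite -mulrA -mulrBr.
  have [|a Ja] := nza g.
    exists h; have -> : f * g - h * x = - (x * h - g * f) by ring.
    exact: idealN.
  exists a; rewrite /colon.
  have -> : x * (h - a * f) = (x * h - g * f) + f * (g - a * x) by ring.
  by apply: idealD => //; apply: idealM.
by rewrite add_genC.
Qed.

End Ideals.

(** * Koszul cochains and the upper bound on the length of regular sequences *)

Section Koszul.
Variables (R : comNzRingType) (I : finType).
Implicit Types (w x : I -> R) (c b : seq I -> R) (l : seq I) (J : R -> Prop).

(** Exterior multiplication by the 1-form with coefficients w, on cochains
    viewed as functions of ordered sequences of indices. No alternation is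
    imposed: the signs come from the recursion, which leads to one-line inductions.
    For w = x this is the Koszul differential. *)
Fixpoint wedge w c l {struct l} : R :=
  if l is v :: l' then w v * c l' - wedge w (fun t => c (v :: t)) l' else 0.

Lemma wedge_ext w c c' l : c =1 c' -> wedge w c l = wedge w c' l.
Proof.
elim: l c c' => [|v l IH] c c' e //=; rewrite e; congr (_ - _).
by apply: IH => t; rewrite e.
Qed.

Lemma wedgeD w c b l : wedge w (fun t => c t + b t) l = wedge w c l + wedge w b l.
Proof. by elim: l c b => [|v l IH] c b /=; rewrite ?addr0 // IH; ring. Qed.

Lemma wedgeZ w a c l : wedge w (fun t => a * c t) l = a * wedge w c l.
Proof. by elim: l c => [|v l IH] c /=; rewrite ?mulr0 // IH; ring. Qed.

Lemma wedgeN w c l : wedge w (fun t => - c t) l = - wedge w c l.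
Proof. by elim: l c => [|v l IH] c /=; rewrite ?oppr0 // IH; ring. Qed.

Lemma wedgeB w c b l : wedge w (fun t => c t - b t) l = wedge w c l - wedge w b l.
Proof. by rewrite wedgeD wedgeN. Qed.

Lemma wedge_scale w a c l : wedge (fun v => a * w v) c l = a * wedge w c l.
Proof. by elim: l c => [|v l IH] c /=; rewrite ?mulr0 // IH; ring. Qed.

Lemma wedge0 w c l : (forall t, c t = 0) -> wedge w c l = 0.
Proof.
elim: l c => [|v l IH] c c0 //=.
by rewrite c0 mulr0 IH ?subr0 // => t; apply: c0.
Qed.

Lemma wedge_sum w (T : Type) (r : seq T) (F : T -> seq I -> R) l :
  wedge w (fun t => \sum_(i <- r) F i t) l = \sum_(i <- r) wedge w (F i) l.
Proof.
elim: r => [|i r IH]; first by rewrite big_nil wedge0 // => t; rewrite big_nil.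
rewrite big_cons -IH -wedgeD; apply: wedge_ext => t; exact: big_cons.
Qed.

Lemma wedge_weight_sum (T : Type) (r : seq T) (W : T -> I -> R) w c l :
  (forall v, w v = \sum_(i <- r) W i v) ->
  wedge w c l = \sum_(i <- r) wedge (W i) c l.
Proof.
move=> e; elim: l c => [|v l IH] c /=; first by rewrite big1.
by rewrite IH e mulr_suml -sumrB.
Qed.

(** Stated separately from wedge_anti, which only gives twice this identity. *)
Lemma wedge_wedge w c l : wedge w (wedge w c) l = 0.
Proof.
elim: l c => [|v l IH] c //=.
by rewrite (wedgeB w (fun t => w v * c t)) wedgeZ IH; ring.
Qed.

Lemma wedge_anti w w' c l : wedge w (wedge w' c) l = - wedge w' (wedge w c) l.
Proof.
elim: l c => [|v l IH] c /=; first by rewrite oppr0.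
rewrite (wedgeB w (fun t => w' v * c t)) (wedgeB w' (fun t => w v * c t)).
by rewrite !wedgeZ IH; ring.
Qed.

Definition contract (g : I -> R) c l : R := \sum_v g v * c (v :: l).

(** Contraction with g is a homotopy between 0 and multiplication by the
    combination of the x v with coefficients g v: this is why elements of (x)
    annihilate Koszul cohomology. *)
Lemma contract_homotopy x g c l :
  contract g (wedge x c) l + wedge x (contract g c) l = (\sum_v g v * x v) * c l.
Proof.
have -> : wedge x (contract g c) l = \sum_v g v * wedge x (fun t => c (v :: t)) l.
  rewrite (@wedge_sum x _ _ (fun v t => g v * c (v :: t))).
  by apply: eq_bigr => v _; rewrite wedgeZ.
rewrite /contract -big_split mulr_suml; apply: eq_bigr => v _ /=; ring.
Qed.

Lemma wedge_mem J w c l : is_ideal J ->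
  (forall v t, (size t).+1 = size l -> J (w v * c t)) -> J (wedge w c l).
Proof.
move=> idJ; elim: l c => [|v l IH] c Jc /=; first exact: ideal0.
apply: idealB => //; first exact: Jc.
by apply: IH => u t st; apply: Jc; rewrite /= st.
Qed.

Definition cocycle J x m c : Prop :=
  forall l, size l = m.+1 -> J (wedge x c l).

Definition coboundary J x m c : Prop :=
  exists b, forall l, size l = m -> J (c l - wedge x b l).

(** Vanishing of Koszul cohomology below the length of a regular sequence.
    The first term f is a combination of the x v, so f c is the differential of
    some b modulo J; then b is a cocycle modulo J + (f), hence by induction
    b = d e + f a there, and f c = f (d a) modulo J lets one cancel f. *)
Lemma weakly_regular_coboundary J x fs m c : is_ideal J ->
  (forall f, f \in fs -> exists g, f = \sum_v g v * x v) ->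
  weakly_regular J fs -> (m < size fs)%N -> cocycle J x m c -> coboundary J x m c.
Proof.
elim: fs J m c => [|f fs IH] J m c idJ //= fsx [nzf reg] lt_m cocyc.
have [g fg] := fsx f (mem_head _ _).
pose b := contract g c.
have Jb l : size l = m -> J (f * c l - wedge x b l).
  move=> sl; rewrite fg -(contract_homotopy x g c l) addrK.
  apply: ideal_sum => // v _; apply: idealM => //.
  by apply: cocyc; rewrite /= sl.
case: m lt_m cocyc Jb => [|m] lt_m cocyc Jb.
  exists (fun=> 0) => l sl; rewrite wedge0 // subr0; apply: nzf.
  by have := Jb l sl; rewrite (size0nil sl) /= subr0.
have [e ebP] : coboundary (add_gen J f) x m b.
  apply: IH => // [|h hfs|l sl]; first exact: add_gen_ideal.
    by apply: fsx; rewrite in_cons hfs orbT.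
  exists (c l); have -> : wedge x b l - c l * f = - (f * c l - wedge x b l) by ring.
  by apply: idealN => //; apply: Jb.
(* The multiples of f are chosen for each sequence separately, by choice. *)
pose a l := if excluded_middle_informative (size l = m) is left sl
  then sval (constructive_indefinite_description _ (ebP l sl)) else 0.
have aP l : size l = m -> J (b l - wedge x e l - a l * f).
  move=> sl; rewrite /a; case: excluded_middle_informative => // sl'.
  by case: constructive_indefinite_description.
exists a => l sl; apply: nzf.
have -> : f * (c l - wedge x a l) = (f * c l - wedge x b l)
    + wedge x (fun t => b t - wedge x e t - a t * f) l.
  rewrite (wedgeB x (fun t => b t - wedge x e t)) wedgeB wedge_wedge.
  rewrite (@wedge_ext x (fun t => a t * f) (fun t => f * a t)) => [|t].
    by rewrite wedgeZ; ring.
  exact: mulrC.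
apply: idealD => //; first exact: Jb.
apply: wedge_mem => // v t; rewrite sl => -[st].
by apply: idealM => //; apply: aP.
Qed.

(** The product of the 1-forms in ws, as a cochain supported on sequences of
    length size ws. *)
Definition wedge_all (ws : seq (I -> R)) : seq I -> R :=
  foldr wedge (fun l => (nilp l)%:R) ws.

Lemma wedge_wedge_all (T : eqType) (W : T -> I -> R) i r l :
  i \in r -> wedge (W i) (wedge_all (map W r)) l = 0.
Proof.
elim: r l => [|j r IH] l //=; rewrite inE => /orP[/eqP-> | ir].
  exact: wedge_wedge.
by rewrite wedge_anti wedge0 ?oppr0 // => t; apply: IH.
Qed.

Lemma wedge_vanish w c l : (forall v, v \in l -> w v = 0) -> wedge w c l = 0.
Proof.
elim: l c => [|v l IH] c w0 //=.
rewrite w0 ?mem_head // mul0r IH ?subr0 // => u ul.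
by rewrite w0 // in_cons ul orbT.
Qed.

(** If the 1-forms have disjoint supports, only the identity permutation
    contributes at a sequence that meets the supports in order. *)
Lemma wedge_all_diag (T : eqType) (W : T -> I -> R) (blk : I -> T) l :
  (forall i v, blk v != i -> W i v = 0) -> uniq (map blk l) ->
  wedge_all (map W (map blk l)) l = \prod_(v <- l) W (blk v) v.
Proof.
move=> W0; elim: l => [|v l IH] /=; first by rewrite big_nil.
move=> /andP[nv ul]; rewrite IH // big_cons wedge_vanish ?subr0 // => u ul'.
by apply: W0; apply: contraNneq nv => <-; apply: map_f.
Qed.

Lemma wedge_all_off (ws : seq (I -> R)) u t :
  all (fun w => w u == 0) ws -> wedge_all ws (u :: t) = 0.
Proof.
elim: ws t => [|w ws IH] t //= /andP[/eqP-> w0].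
by rewrite mul0r wedge0 ?subr0 // => t'; apply: IH.
Qed.

(** The factor a serves the induction on ws, which moves the coefficients
    already chosen into it. *)
Lemma wedge_all_ideal J a (ws : seq (I -> R)) l : is_ideal J ->
  (forall vs, size vs = size ws ->
     J (a * \prod_(p <- zip ws vs) p.1 p.2)) -> J (a * wedge_all ws l).
Proof.
move=> idJ; elim: ws a l => [|w ws IH] a l Jp /=.
  have := Jp [::] erefl; rewrite big_nil mulr1 => Ja.
  exact: idealMr.
apply: (wedge_mem (colon_ideal idJ a)) => v t _.
rewrite /colon mulrA; apply: IH => vs svs.
by have := Jp (v :: vs); rewrite /= svs big_cons mulrA; apply.
Qed.

End Koszul.

(** * Monomial ideals given by supports, and elementary symmetric polynomials *)

Section MonomialIdeals.
Variables (K : fieldType) (n : nat).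
Local Notation S := {mpoly K[n]}.
Implicit Types (J : S -> Prop) (f g h : S) (N : pred {set 'I_n}).
Implicit Types (A B C U W : {set 'I_n}) (m : 'X_{1..n}).

Definition mnm_supp m : {set 'I_n} := [set i | m i != 0%N].

Lemma mnm_suppD m m' : mnm_supp (m + m')%MM = mnm_supp m :|: mnm_supp m'.
Proof. by apply/setP => i; rewrite !inE mnmDE addn_eq0 negb_and. Qed.

Lemma mnm_supp_mesym1 C : mnm_supp (mesym1 C) = C.
Proof. by apply/setP => i; rewrite !inE mnmE; case: (i \in C). Qed.

Lemma card_mnm_supp m : (#|mnm_supp m| <= mdeg m)%N.
Proof.
rewrite mdegE -sum1_card big_mkcond /=; apply: leq_sum => i _.
by rewrite inE; case: eqP => //= /eqP; rewrite lt0n.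
Qed.

(** For upward closed N, the squarefree monomial ideal of the simplicial complex
    whose nonfaces are the members of N. *)
Definition support_ideal N : S -> Prop :=
  fun f => forall m, m \in msupp f -> N (mnm_supp m).

Definition up_closed N : Prop := forall U W, U \subset W -> N U -> N W.

Lemma support_ideal_ext N N' : N =1 N' -> support_ideal N = support_ideal N'.
Proof.
by move=> e; apply: predicate_ext => h; split=> Jh m /Jh; rewrite e.
Qed.

Lemma support_ideal_ideal N : up_closed N -> is_ideal (support_ideal N).
Proof.
move=> upN; split=> [m|f g Jf Jg m|f g Jg m].
- by rewrite msupp0.
- by move/msuppD_le; rewrite mem_cat => /orP[/Jf|/Jg].
- case/msuppM_le/allpairsP=> -[m1 m2] /= [_ /Jg Nm2 ->].
  by apply: upN Nm2; rewrite mnm_suppD subsetUr.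
Qed.

Lemma support_idealX N m : support_ideal N 'X_[m] <-> N (mnm_supp m).
Proof.
split=> [|Nm m']; last by rewrite msuppX inE => /eqP->.
by apply; rewrite msuppX mem_head.
Qed.

Lemma ideal_monomials J h : is_ideal J ->
  (forall m, m \in msupp h -> J 'X_[m]) -> J h.
Proof.
move=> idJ Jm; rewrite [h]mpolyE big_seq; apply: ideal_sum => // m mh.
by rewrite -mul_mpolyC; apply: idealM => //; apply: Jm.
Qed.

Lemma colon_support N C :
  colon (support_ideal N) 'X_[mesym1 C] = support_ideal (fun U => N (C :|: U)).
Proof.
apply: predicate_ext => h; rewrite /colon /support_ideal mulrC; split=> Jh m.
  move=> mh; have := Jh (mesym1 C + m)%MM; rewrite mnm_suppD mnm_supp_mesym1.
  by apply; rewrite (perm_mem (msuppMX _ _)); apply: map_f.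
rewrite (perm_mem (msuppMX _ _)) => /mapP[m' /Jh + ->].
by rewrite mnm_suppD mnm_supp_mesym1.
Qed.

Lemma mnm_mesym1_divides C m : C \subset mnm_supp m ->
  exists m', m = (m' + mesym1 C)%MM.
Proof.
move=> sC; exists (m - mesym1 C)%MM; rewrite submK //.
apply/mnm_lepP => i; rewrite mnmE; case: (boolP (i \in C)) => //= iC.
by have := subsetP sC i iC; rewrite inE lt0n.
Qed.

Lemma add_gen_support N C : up_closed N ->
  add_gen (support_ideal N) 'X_[mesym1 C]
    = support_ideal (fun U => N U || (C \subset U)).
Proof.
move=> upN; have idN := support_ideal_ideal upN.
have up' : up_closed (fun U => N U || (C \subset U)).
  move=> U W sUW /orP[/(upN _ _ sUW)-> //|sCU].
  by rewrite (subset_trans sCU sUW) orbT.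
apply: predicate_ext => h; split.
  move=> [a Ja]; rewrite -(subrK (a * 'X_[mesym1 C]) h).
  apply: (idealD (support_ideal_ideal up')); first by move=> m /Ja ->.
  apply: (idealM (support_ideal_ideal up')); apply/support_idealX.
  by rewrite mnm_supp_mesym1 subxx orbT.
move=> Jh; apply: ideal_monomials => [|m /Jh /orP[Nm|sC]].
- exact: add_gen_ideal.
- by apply: add_gen_sub; apply/support_idealX.
- have [m' ->] := mnm_mesym1_divides sC; rewrite mpolyXD.
  exact: (add_gen_mem idN).
Qed.

Lemma add_gen_congr J f g : is_ideal J -> J (f - g) -> add_gen J f = add_gen J g.
Proof.
move=> idJ Jfg; apply: predicate_ext => h; split=> -[a Ja]; exists a.
  have -> : h - a * g = (h - a * f) + a * (f - g) by ring.
  by apply: idealD => //; apply: idealM.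
have -> : h - a * f = (h - a * g) - a * (f - g) by ring.
by apply: idealB => //; apply: idealM.
Qed.

Local Notation component d := (pihomog [measure of mdeg] d).

Definition graded J : Prop := forall h d, J h -> J (component d h).

Lemma support_ideal_graded N : up_closed N -> graded (support_ideal N).
Proof.
move=> upN h d Jh; rewrite pihomogE big_seq_cond.
apply: (ideal_sum (support_ideal_ideal upN)) => m /andP[mh _].
rewrite -mul_mpolyC; apply: (idealM (support_ideal_ideal upN)).
by apply/support_idealX; apply: Jh.
Qed.

Lemma component_mulr a f e d : f \is e.-homog ->
  component d (a * f) = (if (e <= d)%N then component (d - e)%N a else 0) * f.
Proof.
move=> hf; have hM d' : component d' a * f \is (d' + e).-homog.
  by apply: dhomogM => //; apply: pihomogP.
rewrite {1}(pihomog_partitionE (leqnn (mmeasure [measure of mdeg] a))).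
set k := mmeasure _ a; rewrite mulr_suml raddf_sum /=.
case: leqP => [le_ed|lt_de]; last first.
  rewrite mul0r big1 // => i _; apply: pihomog_ne0 (hM i).
  by rewrite neq_ltn (leq_trans lt_de (leq_addl _ _)) orbT.
have other (i : nat) : i != (d - e)%N -> component d (component i a * f) = 0.
  by move=> ne; apply: pihomog_ne0 (hM i); apply: contra ne => /eqP; lia.
have main : component d (component (d - e)%N a * f) = component (d - e)%N a * f.
  by apply: pihomog_dE; have := hM (d - e)%N; rewrite subnK.
have [lt_k|ge_k] := ltnP (d - e)%N k.
  rewrite (bigD1 (Ordinal lt_k)) //= main big1 ?addr0 // => i ne.
  by apply: other.
rewrite big1 => [|i _]; last by apply: other; rewrite neq_ltn (leq_trans _ ge_k).
suff -> : component (d - e)%N a = 0 by rewrite mul0r.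
rewrite pihomogE big_seq_cond big1 // => m /andP[mh /eqP em].
by have := mmeasure_mnm_lt [measure of mdeg] mh; rewrite em -/k ltnNge ge_k.
Qed.

Lemma add_gen_graded J f e : is_ideal J -> graded J -> f \is e.-homog ->
  graded (add_gen J f).
Proof.
move=> idJ grJ hf h d [a Ja].
exists (if (e <= d)%N then component (d - e)%N a else 0).
by rewrite -(component_mulr _ _ hf) -raddfB; apply: grJ.
Qed.

(** Krull separation for a graded ideal: modulo a power of X_i beyond the degree
    of h, no homogeneous component of h is affected. *)
Lemma graded_separated J (i : 'I_n) h : is_ideal J -> graded J ->
  (forall p, exists a, J (h - a * 'X_i ^+ p)) -> J h.
Proof.
move=> idJ grJ sep; set k := mmeasure [measure of mdeg] h.
have [a Ja] := sep k.
rewrite (pihomog_partitionE (leqnn k)); apply: ideal_sum => // d _.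
have := grJ _ d Ja; rewrite raddfB /= (@component_mulr _ _ k).
  by rewrite leqNgt ltn_ord /= mul0r subr0.
by rewrite mpolyXn dhomogX /= mdegMn mdeg1 mul1n.
Qed.

(** A homogeneous sequence that is regular after X_i is also regular before it:
    the case of graded Nakayama that permutes X_i to the end of the sequence. *)
Lemma weakly_regular_lift J (i : 'I_n) fs : is_ideal J -> graded J ->
  nonzerodivisor J 'X_i ->
  (forall f, f \in fs -> exists d, f \is d.-homog) ->
  weakly_regular (add_gen J 'X_i) fs -> weakly_regular J fs.
Proof.
elim: fs J => [|f fs IH] J idJ grJ nzx hom //= [nzf reg]; split.
  move=> h Jfh; apply: (graded_separated (i := i)) => //.
  (* By induction on p, h is divisible by X_i^p modulo J. *)
  elim=> [|p [a Ja]]; first by exists h; rewrite expr0 mulr1 subrr; apply: ideal0.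
  have nzxp b : J ('X_i ^+ p * b) -> J b.
    by elim: (p) b => [|M IHM] b; rewrite ?mul1r // exprS -mulrA => /nzx /IHM.
  have Jfa : J (f * a).
    apply: nzxp.
    have -> : 'X_i ^+ p * (f * a) = f * h - f * (h - a * 'X_i ^+ p) by ring.
    by apply: idealB => //; apply: idealM.
  have [|b Jb] := nzf a; first exact: add_gen_sub.
  exists b.
  have -> : h - b * 'X_i ^+ p.+1
     = (h - a * 'X_i ^+ p) + 'X_i ^+ p * (a - b * 'X_i) by rewrite exprS; ring.
  by apply: idealD => //; apply: idealM.
have [d hf] := hom f (mem_head _ _).
apply: IH.
- exact: add_gen_ideal.
- exact: add_gen_graded hf.
- move=> h [a Ja]; have [|b Jb] := nzf a.
    by exists h; have -> : f * a - h * 'X_i = - ('X_i * h - a * f) by [ring];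
       apply: idealN.
  exists b; apply: nzx.
  have -> : 'X_i * (h - b * f) = ('X_i * h - a * f) + f * (a - b * 'X_i) by ring.
  by apply: idealD => //; apply: idealM.
- by move=> g gfs; apply: hom; rewrite in_cons gfs orbT.
- by rewrite add_genC.
Qed.

(** Decreasing degrees matter: on a polynomial ring in exactly r variables e_r
    is a monomial, so the first quotient is again given by a monomial ideal. *)
Fixpoint esym_seq r : seq S :=
  if r is r'.+1 then mesym n K r :: esym_seq r' else [::].

Lemma size_esym_seq r : size (esym_seq r) = r.
Proof. by elim: r => //= r ->. Qed.

Lemma mesym_homog r : mesym n K r \is r.-homog.
Proof.
rewrite mesymE; apply: rpred_sum => C /eqP <-.
by rewrite dhomogX /= mdeg_mesym1.
Qed.

Lemma esym_seq_homog r f : f \in esym_seq r ->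
  exists2 d, (0 < d)%N & f \is d.-homog.
Proof.
elim: r => //= r IH; rewrite inE => /orP[/eqP->|]; last exact: IH.
by exists r.+1 => //; apply: mesym_homog.
Qed.

Definition meets B U := [exists i in B, i \in U].

(** The nonfaces that describe the ideal (J : x_A) + (x_B), where J is the
    monomial ideal given by N. *)
Definition colon_add N A B U := N (A :|: U) || meets B U.

Lemma up_closed_colon_add N A B : up_closed N -> up_closed (colon_add N A B).
Proof.
move=> upN U W sUW /orP[NU|/exists_inP[i iB iU]]; apply/orP; [left|right].
  by apply: upN NU; apply: setUS.
by apply/exists_inP; exists i => //; apply: (subsetP sUW).
Qed.

Lemma colon_add0 N : colon_add N set0 set0 =1 N.
Proof.
move=> U; rewrite /colon_add set0U; case: (N U) => //=.
by apply/exists_inP => -[i]; rewrite inE.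
Qed.

Lemma meetsU1l v B U : meets (v |: B) U = (v \in U) || meets B U.
Proof.
apply/exists_inP/orP => [[i /setU1P[->|iB] iU]|[vU|/exists_inP[i iB iU]]].
- by left.
- by right; apply/exists_inP; exists i.
- by exists v; rewrite ?setU11.
- by exists i; rewrite // setU1r.
Qed.

Lemma meetsU1r v B U : v \notin B -> meets B (v |: U) = meets B U.
Proof.
move=> vB; apply/exists_inP/exists_inP => -[i iB iU]; exists i => //.
  by case/setU1P: iU iB vB => // -> ->.
by rewrite setU1r.
Qed.

Lemma colon_add_split N A B v fs : up_closed N -> v \notin B ->
  weakly_regular (support_ideal (colon_add N (v |: A) B)) fs ->
  weakly_regular (support_ideal (colon_add N A (v |: B))) fs ->
  weakly_regular (support_ideal (colon_add N A B)) fs.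
Proof.
move=> upN vB reg1 reg2; have up' := @up_closed_colon_add N A B upN.
apply: (@weakly_regular_split _ _ 'X_[mesym1 [set v]]).
- exact: support_ideal_ideal.
- rewrite colon_support; congr weakly_regular: reg1; apply: support_ideal_ext => U.
  by rewrite /colon_add meetsU1r // setUA [A :|: _]setUC.
- rewrite add_gen_support //; congr weakly_regular: reg2.
  apply: support_ideal_ext => U.
  by rewrite /colon_add meetsU1l sub1set -orbA [_ || meets _ _]orbC.
Qed.

(** Splitting along all the variables of X. The leaves of the resulting tree are
    the partitions of X into inverted variables A and killed variables B. *)
Lemma colon_add_partition N fs (X : {set 'I_n}) : up_closed N ->
  (forall A B, A :|: B = X -> [disjoint A & B] ->
     weakly_regular (support_ideal (colon_add N A B)) fs) ->
  weakly_regular (support_ideal (colon_add N set0 set0)) fs.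
Proof.
move=> upN leaves.
suff split A B : A :|: B \subset X -> [disjoint A & B] ->
    weakly_regular (support_ideal (colon_add N A B)) fs.
  by apply: split; rewrite ?setU0 ?sub0set // -setI_eq0 set0I.
have [k] := ubnP #|X :\: (A :|: B)|; elim: k A B => // k IH A B /ltnSE le_k sX dAB.
have [eX|[v]] := set_0Vmem (X :\: (A :|: B)).
  by apply: leaves => //; apply/eqP; rewrite eqEsubset sX -setD_eq0 eX eqxx.
move=> vX; have := vX; rewrite !inE negb_or => /andP[/andP[vA vB] Xv].
have lt_k : (#|X :\: (v |: (A :|: B))| < k)%N.
  apply: leq_trans le_k; rewrite (cardsD1 v (X :\: (A :|: B))) vX.
  by rewrite setDDl [_ :|: [set v]]setUC.
apply: (colon_add_split upN vB); apply: IH.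
- by rewrite -setUA.
- by rewrite -setUA subUset sub1set Xv.
- by rewrite disjoints_subset subUset sub1set inE vB -disjoints_subset.
- by rewrite setUCA.
- by rewrite setUCA subUset sub1set Xv.
- rewrite disjoint_sym disjoints_subset subUset sub1set inE vA /=.
  by rewrite -disjoints_subset disjoint_sym.
Qed.

(** Splits along the remaining variables until the complement of B is a face, when
    only the variables of B are left as generators, or A is a nonface, when the
    ideal is the unit ideal. Just before a variable is killed the complement of B
    is in N, so it has more than r elements and at least r remain afterwards. The
    regularity on coordinate subspaces is a hypothesis because
    weakly_regular_coordinate applies this lemma in lower length. *)
Lemma weakly_regular_tree r N A B : up_closed N ->
  (forall C, (r <= #|~: C|)%N ->
     weakly_regular (support_ideal (meets C)) (esym_seq r)) ->
  [disjoint A & B] -> (r <= #|~: B|)%N ->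
  (forall W, A \subset W -> W \subset ~: B -> N W -> (r < #|W|)%N) ->
  weakly_regular (support_ideal (colon_add N A B)) (esym_seq r).
Proof.
move=> upN base; have [k] := ubnP #|~: (A :|: B)|.
elim: k A B => // k IH A B /ltnSE le_k dAB rB NW.
have sAB : A \subset ~: B by rewrite -disjoints_subset.
have [NB|/negP notNB] := boolP (N (~: B)); last first.
  rewrite (@support_ideal_ext _ (meets B)); first exact: base.
  move=> U; rewrite /colon_add; case: (boolP (meets B U)); rewrite ?orbT // => mU.
  rewrite orbF; apply/negP => NU; apply: notNB; apply: upN NU.
  rewrite subUset sAB /=; apply/subsetP => i iU; rewrite inE; apply: contra mU => iB.
  by apply/exists_inP; exists i.
have [eAB|[v]] := set_0Vmem (~: (A :|: B)).
  apply: weakly_regular_full => h m _; apply/orP; left; apply: upN NB.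
  apply: subset_trans (subsetUl _ _); apply/subsetP => i iB.
  have : i \notin ~: (A :|: B) by rewrite eAB inE.
  by move: iB; rewrite !inE negbK => /negbTE->; rewrite orbF.
rewrite !inE negb_or => /andP[vA vB].
have ltk C : v \in C -> (A :|: B) \subset C -> (#|~: C| < k)%N.
  move=> vC sC; apply: leq_trans le_k; apply: proper_card; rewrite properE.
  rewrite setCS sC /=; apply/subsetPn; exists v; rewrite ?inE ?negb_or ?vA ?vB //.
  by rewrite negbK.
apply: (colon_add_split upN vB); apply: IH.
- by apply: ltk; rewrite ?inE ?eqxx // setUSS // subsetUr.
- by rewrite disjoints_subset subUset sub1set inE vB.
- exact: rB.
- move=> W sW; apply: NW; apply: subset_trans sW; exact: subsetUr.
- by apply: ltk; rewrite ?inE ?eqxx ?orbT // setUSS // subsetUr.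
- rewrite disjoint_sym disjoints_subset subUset sub1set inE vA /=.
  by rewrite -disjoints_subset disjoint_sym.
- have : (r < #|~: B|)%N by apply: NW.
  by rewrite (cardsD1 v) inE vB /= setCU setIC -setDE.
- move=> W sAW sW; apply: NW => //; apply: subset_trans sW _.
  by rewrite setCS subsetUr.
Qed.

(** Induction on the length and on the number of free variables. With exactly
    r free variables the first polynomial e_r is congruent to their product M, and
    modulo M one gets the boundary of a simplex, which is split into coordinate
    subspaces of dimension at least r-1. With more free variables, one of them is
    set to zero and weakly_regular_lift is applied. *)
Lemma weakly_regular_coordinate r B : (r <= #|~: B|)%N ->
  weakly_regular (support_ideal (meets B)) (esym_seq r).
Proof.
have up_meets C : up_closed (meets C).
  move=> U W sUW /exists_inP[i iB iU].
  by apply/exists_inP; exists i => //; apply: (subsetP sUW).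
elim: r B => // r IHr B; have [k] := ubnP #|~: B|.
elim: k B => // k IHk B /ltnSE le_k; rewrite leq_eqVlt => /orP[/eqP rB|rB].
  pose P := meets B; pose M := 'X_[mesym1 (~: B)] : S.
  have idP : is_ideal (support_ideal P) := support_ideal_ideal (up_meets B).
  (* The other monomials of e_(r+1) involve a variable of B. *)
  have eM : support_ideal P (mesym n K r.+1 - M).
    rewrite mesymE (bigD1 (~: B)) ?rB //= addrAC subrr add0r.
    apply: (ideal_sum idP) => C /andP[/eqP cC neC]; apply/support_idealX.
    rewrite mnm_supp_mesym1 /P; apply: contraR neC => mC.
    rewrite eqEcard cC leqnn andbT; apply/subsetP => i iC.
    by rewrite inE; apply: contra mC => iB; apply/exists_inP; exists i.
  split.
    move=> h Jh; have : colon (support_ideal P) M h.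
      rewrite /colon; have -> : M * h = mesym n K r.+1 * h - h * (mesym n K r.+1 - M).
        by ring.
      by apply: (idealB idP Jh); apply: (idealM idP _ eM).
    rewrite colon_support => Jh' m /Jh' /exists_inP[i iB].
    by rewrite !inE iB /= => im; apply/exists_inP; exists i; rewrite ?inE.
  rewrite (add_gen_congr idP eM) (add_gen_support _ (up_meets B)).
  pose N U := ~: B \subset U.
  rewrite (@support_ideal_ext _ (colon_add N set0 B)); last first.
    by move=> U; rewrite /colon_add set0U orbC.
  apply: weakly_regular_tree => //.
  - by move=> U W sUW sU; apply: subset_trans sU sUW.
  - by rewrite -setI_eq0 set0I.
  - by rewrite -rB.
  - by move=> W _ _ /subset_leq_card; rewrite -rB.
have [v vB] : exists v, v \in ~: B.
  by apply/set0Pn; rewrite -card_gt0; apply: leq_trans rB.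
have cB : #|~: B| = #|~: (v |: B)|.+1.
  by rewrite (cardsD1 v) vB setCU setIC -setDE.
apply: (@weakly_regular_lift _ v).
- exact: support_ideal_ideal (up_meets B).
- exact: support_ideal_graded (up_meets B).
- move=> h; rewrite -mesym1_set1 -/(colon _ _ _) colon_support => Jh m /Jh.
  by rewrite meetsU1r //; move: vB; rewrite inE.
- by move=> f /esym_seq_homog [d _ hf]; exists d.
rewrite -mesym1_set1 (add_gen_support _ (up_meets B)).
rewrite (@support_ideal_ext _ (meets (v |: B))); last first.
  by move=> U; rewrite meetsU1l sub1set orbC.
by apply: IHk; rewrite -ltnS -cB.
Qed.

Lemma weakly_regular_esym r N A B : up_closed N -> [disjoint A & B] ->
  (r <= #|~: B|)%N ->
  (forall W, A \subset W -> W \subset ~: B -> N W -> (r < #|W|)%N) ->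
  weakly_regular (support_ideal (colon_add N A B)) (esym_seq r).
Proof.
by move=> upN; apply: weakly_regular_tree => // C; apply: weakly_regular_coordinate.
Qed.

End MonomialIdeals.

(** * Depth of ideals of a polynomial ring *)

Section Depth.
Variables (K : fieldType) (n : nat).
Local Notation S := {mpoly K[n]}.
Implicit Types (A I J : S -> Prop) (f g h : S) (fs : seq S).

Lemma ideal_gen_ideal A : is_ideal (ideal_gen A).
Proof.
split=> [|a b [t At ->] [u Au ->]|c a [t At ->]].
- by exists [::]; rewrite ?big_nil.
- exists (t ++ u); rewrite ?big_cat // => p.
  by rewrite mem_cat => /orP[/At|/Au].
- exists [seq (c * p.1, p.2) | p <- t]; first by move=> p /mapP[q /At + ->].
  by rewrite big_map mulr_sumr; apply: eq_bigr => p _; rewrite mulrA.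
Qed.

Lemma ideal_gen_mem A f : A f -> ideal_gen A f.
Proof.
move=> Af; exists [:: (1, f)]; last by rewrite big_seq1 mul1r.
by move=> p; rewrite inE => /eqP->.
Qed.

Lemma ideal_gen_min A J : is_ideal J -> (forall f, A f -> J f) ->
  forall f, ideal_gen A f -> J f.
Proof.
move=> idJ AJ f [t At ->]; rewrite big_seq; apply: ideal_sum => // p pt.
by apply: idealM => //; apply/AJ/At.
Qed.

Lemma ideal_add_nil I : is_ideal I -> ideal_add I [::] = I.
Proof.
move=> idI; apply: predicate_ext => h; split=> [|Ih].
  by apply: ideal_gen_min => // f [|].
by apply: ideal_gen_mem; left.
Qed.

Lemma ideal_add_cons I f fs : is_ideal I ->
  ideal_add I (f :: fs) = ideal_add (add_gen I f) fs.
Proof.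
move=> idI; apply: predicate_ext => h; split.
  apply: ideal_gen_min => [|g [Ig|]]; first exact: ideal_gen_ideal.
    by apply: ideal_gen_mem; left; apply: add_gen_sub.
  rewrite inE => /orP[/eqP->|gfs]; apply: ideal_gen_mem; last by right.
  by left; exists 1; rewrite mul1r subrr; apply: ideal0.
have idG := ideal_gen_ideal (fun g => I g \/ g \in f :: fs).
apply: ideal_gen_min => // g [[a Ia]|gfs]; last first.
  by apply: ideal_gen_mem; right; rewrite inE gfs orbT.
rewrite -(subrK (a * f) g); apply: (idealD idG).
  by apply: ideal_gen_mem; left.
by apply: (idealM idG); apply: ideal_gen_mem; right; apply: mem_head.
Qed.

Lemma weakly_regularP I fs : is_ideal I ->
  weakly_regular I fs <->
  (forall i, (i < size fs)%N -> forall h,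
     ideal_add I (take i fs) (fs`_i * h) -> ideal_add I (take i fs) h).
Proof.
elim: fs I => [|f fs IH] I idI; first by split.
have idIf := add_gen_ideal idI f.
split=> /= [[nzf /(IH _ idIf) reg] [_|i lt_i] h /=|reg].
- by rewrite ideal_add_nil //; apply: nzf.
- by rewrite ideal_add_cons //; apply: reg.
- split; first by move=> h; have := reg 0%N isT h; rewrite /= ideal_add_nil.
  apply/(IH _ idIf) => i lt_i h; have := reg i.+1 lt_i h.
  by rewrite /= ideal_add_cons.
Qed.

(** Membership in the d-th power of the graded maximal ideal. *)
Definition low_degree d : S -> Prop :=
  fun f => forall m, m \in msupp f -> (d <= mdeg m)%N.

Lemma low_degree_ideal d : is_ideal (low_degree d).
Proof.
split=> [m|f g Jf Jg m|f g Jg m].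
- by rewrite msupp0.
- by move/msuppD_le; rewrite mem_cat => /orP[/Jf|/Jg].
- case/msuppM_le/allpairsP=> -[m1 m2] /= [_ /Jg dm2 ->].
  by rewrite mdegD (leq_trans dm2) ?leq_addl.
Qed.

Lemma low_degreeMX d i h : low_degree d h -> low_degree d.+1 ('X_i * h).
Proof.
rewrite mulrC => dh m; rewrite (perm_mem (msuppMX _ _)) => /mapP[m' /dh dm' ->].
by rewrite mdegD mdeg1 addSn.
Qed.

Lemma low_degreeX d m : low_degree d 'X_[m] -> (d <= mdeg m)%N.
Proof. by apply; rewrite msuppX mem_head. Qed.

Lemma in_max_idealP f : in_max_ideal f <-> low_degree 1 f.
Proof.
rewrite /in_max_ideal; split=> [/eqP f0 m|low].
  by apply: contraTT; rewrite -eqn0Ngt mdeg_eq0 => /eqP->; rewrite mcoeff_msupp f0 eqxx.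
by rewrite -[_ == 0]negbK -mcoeff_msupp; apply/negP => /low; rewrite mdeg0.
Qed.

Lemma max_ideal_combination f : in_max_ideal f ->
  exists q : 'I_n -> S, f = \sum_i q i * 'X_i.
Proof.
move/in_max_idealP => low; pose J h := exists g : 'I_n -> S, h = \sum_i g i * 'X_i.
have idJ : is_ideal J.
  split=> [|a b [g ->] [g' ->]|c a [g ->]].
  - by exists (fun=> 0); rewrite big1 // => i _; rewrite mul0r.
  - exists (fun i => g i + g' i); rewrite -big_split.
    by apply: eq_bigr => i _; rewrite mulrDl.
  - exists (fun i => c * g i); rewrite mulr_sumr.
    by apply: eq_bigr => i _; rewrite mulrA.
apply: (ideal_monomials idJ) => m /low; rewrite lt0n mdeg_eq0 => m0.
have [i mi] : exists i, m i != 0%N.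
  apply/existsP; apply: contraR m0; rewrite negb_exists => /forallP m0.
  by apply/eqP/mnmP => i; rewrite mnm0E; apply/eqP; rewrite -[_ == _]negbK.
have [|m' ->] := @mnm_mesym1_divides n [set i] m.
  by rewrite sub1set inE.
rewrite mesym1_set1 mpolyXD; exists (fun j => if j == i then 'X_[m'] else 0).
by rewrite (bigD1 i) //= eqxx big1 ?addr0 // => j /negbTE->; rewrite mul0r.
Qed.

Lemma depth_seq_bound I m c r : is_ideal I ->
  cocycle I (fun i => 'X_i) m c -> ~ coboundary I (fun i => 'X_i) m c ->
  depth_seq I r -> (r <= m)%N.
Proof.
move=> idI cc ncb [fs [<- /allP fsm [reg _]]]; rewrite leqNgt; apply/negP => lt_m.
apply: ncb; apply: (weakly_regular_coboundary idI) lt_m cc.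
  by move=> f /fsm; apply: max_ideal_combination.
exact/weakly_regularP.
Qed.

(** The top Koszul class: the product of all basis 1-forms is killed by every
    X_i e_i and takes the value 1, whereas coboundaries have values without
    constant term. *)
Lemma depth_seq_le_n I r : is_ideal I -> (forall f, I f -> low_degree 1 f) ->
  depth_seq I r -> (r <= n)%N.
Proof.
move=> idI I1; pose W (i : 'I_n) (j : 'I_n) : S := (j == i)%:R.
pose c := wedge_all (map W (enum 'I_n)).
apply: (@depth_seq_bound I n c) => // [l _|[b cb]].
  rewrite (@wedge_weight_sum _ _ _ (enum 'I_n) (fun i j => 'X_i * W i j)).
    rewrite big1_seq; [exact: ideal0 | move=> i /andP[_ ie]].
    by rewrite wedge_scale wedge_wedge_all ?mulr0.
  move=> i; rewrite big_enum /= (bigD1 i) //= /W eqxx mulr1 big1 ?addr0 // => j.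
  by rewrite eq_sym => /negbTE->; rewrite mulr0.
have := cb (enum 'I_n); rewrite size_enum_ord => /(_ erefl) /I1 low.
have cE : c (enum 'I_n) = 1.
  rewrite /c -{1}(map_id (enum 'I_n)) (@wedge_all_diag _ _ _ W id).
  - by rewrite big1 // => i _; rewrite /W eqxx.
  - by move=> i v /negbTE ne; rewrite /W ne.
  - by rewrite map_id enum_uniq.
suff /low_degreeX : low_degree 1 'X_[0] by rewrite mdeg0.
have idm := low_degree_ideal 1.
rewrite mpolyX0 -cE -(subrK (wedge (fun i => 'X_i) b (enum 'I_n)) (c _)).
apply: (idealD idm low); apply: (wedge_mem idm) => v t _.
by apply: low_degreeMX => m _.
Qed.

(** Without an upper bound on the lengths the value chosen by depth would be
    arbitrary. *)
Lemma is_depth_depth I : is_ideal I -> (forall f, I f -> low_degree 1 f) ->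
  is_depth I (depth I).
Proof.
move=> idI I1; apply: epsilon_spec.
pose P r : bool := if excluded_middle_informative (depth_seq I r) then true else false.
have PP r : P r <-> depth_seq I r by rewrite /P; case: excluded_middle_informative.
have exP : exists r, P r.
  exists 0%N; apply/PP; exists [::]; split=> //; split=> //.
  rewrite ideal_add_nil // => /I1; rewrite -mpolyX0 => /low_degreeX.
  by rewrite mdeg0.
have ubP r : P r -> (r <= n)%N by move/PP; apply: depth_seq_le_n.
case: (ex_maxnP exP ubP) => d /PP dd dmax; exists d; split=> // r /PP; exact: dmax.
Qed.

Lemma depth_seq_esym (N : pred {set 'I_n}) r : up_closed N -> ~~ N set0 ->
  weakly_regular (support_ideal N) (esym_seq K n r) ->
  depth_seq (support_ideal N : S -> Prop) r.
Proof.
move=> upN N0 reg; have idN := support_ideal_ideal K upN.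
have low f : f \in esym_seq K n r -> low_degree 1 f.
  move=> /esym_seq_homog[d d_gt0 /dhomogP hf] m /hf /= ->; exact: d_gt0.
exists (esym_seq K n r); split; first exact: size_esym_seq.
  by apply/allP => f /low /in_max_idealP.
split; first exact/weakly_regularP.
move=> one; suff /low_degreeX : low_degree 1 'X_[0] by rewrite mdeg0.
rewrite mpolyX0; apply: ideal_gen_min one; first exact: low_degree_ideal.
move=> f [Nf m /Nf|]; last exact: low.
rewrite lt0n mdeg_eq0; apply: contraL => /eqP->.
suff -> : mnm_supp (0%MM : 'X_{1..n}) = set0 by [].
by apply/setP => i; rewrite !inE mnmE.
Qed.

End Depth.

(** * Matchings and squarefree powers *)

Section Matchings.
Variable G : sgraph.
Implicit Types (M : {set {set G}}) (U : {set G}).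

Definition has_matching k U : bool :=
  [exists M : {set {set G}}, k_matching k M && (cover M \subset U)].

Lemma edgeP (e : {set G}) :
  reflect (exists u v, adj u v /\ e = [set u; v]) (e \in edges G).
Proof.
apply: (iffP imset2P) => [[u v _] | [u [v [uv ->]]]].
  by rewrite inE => /andP[_ uv] ->; exists u, v.
by exists u v; rewrite // !inE.
Qed.

Lemma card_edge (e : {set G}) : e \in edges G -> #|e| = 2.
Proof.
case/edgeP=> u [v [uv ->]]; rewrite cards2.
by case: eqP uv => // ->; rewrite adj_irr.
Qed.

Lemma card_cover_matching k M : k_matching k M -> #|cover M| = (2 * k)%N.
Proof.
case/andP=> /andP[/subsetP Me /eqP <-] /eqP <-.
rewrite (eq_bigr (fun=> 2)) => [|e /Me]; last exact: card_edge.
by rewrite sum_nat_const mulnC.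
Qed.

Lemma has_matchingS k U U' : U \subset U' -> has_matching k U -> has_matching k U'.
Proof.
move=> sU /existsP[M /andP[kM cM]]; apply/existsP; exists M.
by rewrite kM (subset_trans cM sU).
Qed.

(** All generators of the k-th squarefree power have degree 2k. *)
Lemma has_matching_card k U : has_matching k U -> (2 * k <= #|U|)%N.
Proof.
by case/existsP=> M /andP[/card_cover_matching <- /subset_leq_card].
Qed.

Lemma has_matching0 U : has_matching 0 U.
Proof.
apply/existsP; exists set0; rewrite /k_matching /matching sub0set cards0 eqxx.
rewrite /cover big_set0 sub0set !andbT; apply/trivIsetP => A B.
by rewrite inE.
Qed.

Lemma has_matchingSn k U u v : adj u v -> u \in U -> v \in U ->
  has_matching k (U :\ u :\ v) -> has_matching k.+1 U.
Proof.
move=> uv uU vU /existsP[M /andP[/andP[/andP[Me tM] /eqP kM] cM]].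
have disj : {in M, forall B : {set G}, [disjoint [set u; v] & B]}.
  move=> B MB; have sB : B \subset U :\ u :\ v.
    by apply: subset_trans cM; apply: bigcup_sup.
  rewrite -setI_eq0; apply/eqP/setP => z; rewrite !inE; apply/negP.
  by case/andP=> /orP[] /eqP-> /(subsetP sB); rewrite !inE eqxx ?andbF.
have M0 : set0 \notin M.
  by apply/negP => /(subsetP Me)/card_edge; rewrite cards0.
have [tM' uvM] := trivIsetU1 disj tM M0.
apply/existsP; exists ([set u; v] |: M).
rewrite /k_matching /matching tM' cardsU1 uvM kM eqxx !andbT.
rewrite subUset sub1set Me andbT; apply/andP; split.
  by apply/edgeP; exists u, v.
apply/bigcupsP => B /setU1P[->|MB].
  by apply/subsetP => z; rewrite !inE => /orP[] /eqP->.
apply: subset_trans (bigcup_sup B MB) (subset_trans cM _).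
by apply/subsetP => z; rewrite !inE => /and3P[].
Qed.

Variable K : fieldType.

(** Sets of variables are translated to sets of vertices through the
    enumeration that indexes the variables. *)
Definition nodes (U : {set 'I_#|G|}) : {set G} := [set v | enum_rank v \in U].

Definition matched k (U : {set 'I_#|G|}) : bool := has_matching k (nodes U).

Lemma nodesS (U U' : {set 'I_#|G|}) : U \subset U' -> nodes U \subset nodes U'.
Proof. by move=> sU; apply/subsetP => v; rewrite !inE; apply: (subsetP sU). Qed.

Lemma card_nodes (U : {set 'I_#|G|}) : #|nodes U| = #|U|.
Proof.
rewrite -(card_imset (mem (nodes U)) enum_rank_inj); apply: eq_card => i.
apply/imsetP/idP => [[v] | iU]; first by rewrite inE => vU ->.
by exists (enum_val i); rewrite ?inE enum_valK.
Qed.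

Lemma matched_up_closed k : up_closed (matched k).
Proof. by move=> U W /nodesS; apply: has_matchingS. Qed.

Lemma matched_card k (U : {set 'I_#|G|}) : matched k U -> (2 * k <= #|U|)%N.
Proof. by rewrite -card_nodes; apply: has_matching_card. Qed.

Lemma matching_monomialE M : trivIset M ->
  matching_monomial K M = 'X_[mesym1 (enum_rank @: cover M)].
Proof.
move=> tM; rewrite /matching_monomial -big_trivIset //.
rewrite mpolyXE_id -[LHS](big_imset (fun i => 'X_i)) /=; last first.
  by move=> u v _ _; apply: enum_rank_inj.
rewrite big_mkcond; apply: eq_bigr => i _; rewrite mnmE.
by case: (i \in _).
Qed.

Lemma squarefree_powerE k :
  squarefree_power (K := K) (G := G) k = support_ideal (matched k).
Proof.
have idP := support_ideal_ideal K (@matched_up_closed k).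
apply: predicate_ext => f; split.
  apply: (ideal_gen_min idP) => g [M kM ->].
  have /andP[/andP[_ tM] _] := kM.
  rewrite matching_monomialE //; apply/support_idealX; rewrite mnm_supp_mesym1.
  apply/existsP; exists M; rewrite kM; apply/subsetP => v vM.
  by rewrite inE; apply: imset_f.
have idS : is_ideal (squarefree_power (K := K) (G := G) k).
  exact: ideal_gen_ideal.
move=> Jf; apply: (ideal_monomials idS) => m /Jf /existsP[M /andP[kM cM]].
have /andP[/andP[_ tM] _] := kM.
have [|m' ->] := @mnm_mesym1_divides _ (enum_rank @: cover M) m.
  by apply/subsetP => _ /imsetP[v vM ->]; have := subsetP cM v vM; rewrite inE.
rewrite mpolyXD -matching_monomialE //; apply: (idealM idS).
by apply: ideal_gen_mem; exists M.
Qed.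

Lemma squarefree_power_ideal k : is_ideal (squarefree_power (K := K) (G := G) k).
Proof. exact: ideal_gen_ideal. Qed.

Lemma squarefree_power_low k f : squarefree_power (K := K) (G := G) k f ->
  low_degree (2 * k) f.
Proof.
rewrite squarefree_powerE => Jf m /Jf /matched_card le.
exact: leq_trans le (card_mnm_supp m).
Qed.

Lemma matched0 k : (0 < k)%N -> ~~ matched k set0.
Proof. by move=> k0; apply/negP => /matched_card; rewrite cards0; lia. Qed.

(** An ideal generated by squarefree monomials of degree 2k contains no monomial
    supported on fewer than 2k variables, and this alone forces depth at least 2k-1. *)
Lemma depth_seq_degree k : (0 < k)%N -> (2 * k - 1 <= #|G|)%N ->
  depth_seq (squarefree_power (K := K) (G := G) k) (2 * k - 1).
Proof.
move=> k0 kG; rewrite squarefree_powerE.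
apply: depth_seq_esym; [exact: matched_up_closed | exact: matched0 |].
rewrite -(support_ideal_ext K (@colon_add0 _ (matched k))).
apply: weakly_regular_esym.
- exact: matched_up_closed.
- by rewrite -setI_eq0 set0I.
- by rewrite setC0 cardsT card_ord.
- by move=> W _ _ /matched_card; lia.
Qed.

End Matchings.

(** * Whiskered complete graphs *)

Section Whiskered.
Variables (s : nat) (a : 'I_s -> nat).
Local Notation G := (whiskered_complete a).
Local Notation hub i := (inl i : G).
Local Notation leaf w := (inr w : G).
Implicit Types (U : {set G}) (T W : {set 'I_s}).

(** Hubs of W are matched to their whiskers and the other hubs of T among
    themselves. The size condition is an inequality, so that no parity of the
    number of remaining hubs has to be tracked. *)
Lemma whiskered_has_matching k T W U : W \subset T ->
  (forall i, i \in T -> hub i \in U) ->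
  (forall i, i \in W -> exists2 w, tag w = i & leaf w \in U) ->
  (2 * k <= #|W| + #|T|)%N -> has_matching k U.
Proof.
elim: k T W U => [|k IH] T W U sWT TU WU le_k; first exact: has_matching0.
have [W0|[i iW]] := set_0Vmem W; last first.
  have [w tw wU] := WU i iW; have iT := subsetP sWT i iW.
  apply: (@has_matchingSn _ _ _ (hub i) (leaf w)); rewrite ?TU ?wU //.
    by rewrite /adj /= tw.
  apply: (IH (T :\ i) (W :\ i)).
  - exact: setSD.
  - by move=> j /setD1P[ji jT]; rewrite !inE TU //= andbT (inj_eq inl_inj).
  - move=> j /setD1P[ji jW]; have [w' tw' w'U] := WU j jW.
    exists w' => //; rewrite !inE w'U !andbT /= (inj_eq inr_inj).
    by apply: contra_neq ji => e; rewrite -tw' -tw e.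
  - by move: le_k; rewrite (cardsD1 i W) iW (cardsD1 i T) iT; lia.
have [i iT] : exists i, i \in T.
  by apply/set0Pn; rewrite -card_gt0; move: le_k; rewrite W0 cards0; lia.
have [j] : exists j, j \in T :\ i.
  apply/set0Pn; rewrite -card_gt0; move: le_k.
  by rewrite W0 cards0 (cardsD1 i T) iT; lia.
rewrite !inE => /andP[ji jT].
apply: (@has_matchingSn _ _ _ (hub i) (hub j)); rewrite ?TU //.
  by rewrite /adj /= eq_sym.
apply: (IH (T :\ i :\ j) set0).
- exact: sub0set.
- by move=> l; rewrite !inE => /and3P[lj li lT]; rewrite !(inj_eq inl_inj) lj li TU.
- by move=> l; rewrite inE.
- move: le_k; rewrite W0 cards0 (cardsD1 i T) iT (cardsD1 j (T :\ i)) !inE ji jT.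
  by lia.
Qed.

(** The only neighbour of a leaf is its hub. *)
Lemma has_matching_isolated k U w : hub (tag w) \notin U ->
  has_matching k U -> has_matching k (U :\ leaf w).
Proof.
move=> nU /existsP[M /andP[kM cM]]; apply/existsP; exists M; rewrite kM /=.
rewrite subsetD1 cM /=; apply/negP => /bigcupP[e eM we].
have /andP[/andP[/subsetP Me _] _] := kM.
have sU : e \subset U by apply: subset_trans cM; apply: bigcup_sup.
case/edgeP: (Me e eM) we sU => u [v [uv ->]].
rewrite !inE subUset !sub1set => /orP[] /eqP e' /andP[uU vU].
  case: u e' uv uU => // w' [<-]; case: v vU => // i iU /eqP ti _.
  by rewrite ti iU in nU.
case: v e' uv vU => // w' [<-]; case: u uU => // i iU /eqP ti _.
by rewrite ti iU in nU.
Qed.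

Lemma matching_hub (M : {set {set G}}) : matching M -> (#|M| <= s)%N.
Proof.
move=> /andP[/subsetP Me tM]; pose H := [set hub i | i in 'I_s].
have hubM e : e \in M -> exists2 v, v \in e & v \in H.
  move=> /Me /edgeP[u [v [uv ->]]].
  case: u uv => [i uv|w]; first by exists (hub i); rewrite ?inE ?eqxx // imset_f.
  by case: v => // i _; exists (hub i); rewrite ?inE ?eqxx ?orbT // imset_f.
have cH : #|H| = s by rewrite card_imset ?card_ord //; apply: inl_inj.
rewrite -[leqRHS]cH -!sum1_card.
apply: (@leq_trans (\sum_(e in M) \sum_(v in e) (v \in H))).
  by apply: leq_sum => e /hubM[v ve vH]; rewrite (bigD1 v ve) /= vH.
rewrite -big_trivIset //= big_mkcond [leqRHS]big_mkcond.
by apply: leq_sum => v _; case: (v \in cover M); case: (v \in H).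
Qed.

Hypothesis a_gt0 : forall i, (0 < a i)%N.

Definition whisker (i : 'I_s) : {i : 'I_s & 'I_(a i)} :=
  existT _ i (Ordinal (a_gt0 i)).

Lemma whiskered_has_matching_max : has_matching s [set: G].
Proof.
apply: (@whiskered_has_matching _ setT setT) => [|i _|i _|];
  rewrite ?in_setT ?cardsT ?card_ord //.
- by exists (whisker i); rewrite ?in_setT.
- by rewrite mul2n addnn.
Qed.

Lemma matching_number_whiskered : matching_number G = s.
Proof.
apply/eqP; rewrite eqn_leq; apply/andP; split.
  by apply/bigmax_leqP => M; apply: matching_hub.
have /existsP[M /andP[/andP[mM /eqP cM] _]] := whiskered_has_matching_max.
by rewrite -[X in (X <= _)%N]cM; apply: leq_bigmax_cond.
Qed.

End Whiskered.

(** * Chordality of split graphs *)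

(** In an induced cycle of length at least 4, u1 and u3 are not adjacent, and
    neither are u0 and u2, so each of these pairs has a member outside the clique
    L. Following consecutive edges forces u1 and u2 into L and u0 and u3 out of L.
    Then u3 u0 is not an edge, so there is a vertex u4 after u3, which lies in L
    and hence is adjacent to u2: a chord. *)
Lemma split_graph_chordal (G : sgraph) (L : pred G) :
  (forall u v, ~~ L u -> ~~ L v -> ~~ adj u v) ->
  (forall u v, L u -> L v -> u != v -> adj u v) -> chordal G.
Proof.
move=> indep clique c [_]; rewrite leqNgt.
case: c => [|u0 [|u1 [|u2 [|u3 r]]]] //; set c := [:: _, _, _, _ & _] => uc adjE.
apply/negP => _.
have [[u0c u1c] [u2c u3c]] :
    ((u0 \in c) * (u1 \in c) * ((u2 \in c) * (u3 \in c)))%type.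
  by rewrite !inE !eqxx !orbT.
have /= := uc; rewrite !inE !negb_or.
case/and5P=> /and4P[n01 n02 n03 n0r] /and3P[n12 n13 n1r] /andP[n23 n2r] n3r ur.
have nx0 : next c u0 = u1 by rewrite /next /= eqxx.
have nx1 : next c u1 = u2 by rewrite /next /= [u1 == u0]eq_sym (negPf n01) eqxx.
have nx2 : next c u2 = u3.
  by rewrite /next /= [u2 == u0]eq_sym [u2 == u1]eq_sym (negPf n02) (negPf n12) eqxx.
have nx3 : next c u3 = head u0 r.
  rewrite /next /= [u3 == u0]eq_sym [u3 == u1]eq_sym [u3 == u2]eq_sym.
  by rewrite (negPf n03) (negPf n13) (negPf n23); case: (r) => [|? ?] /=; rewrite eqxx.
have a01 : adj u0 u1 by rewrite adjE // nx0 eqxx.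
have a12 : adj u1 u2 by rewrite adjE // nx1 eqxx.
have a23 : adj u2 u3 by rewrite adjE // nx2 eqxx.
have a02 : ~~ adj u0 u2.
  by rewrite adjE // nx0 nx2 eq_sym negb_or n12 n03.
have h1r : u1 != head u0 r.
  by case: (r) n1r => [|u4 r'] /=; rewrite 1?eq_sym // inE negb_or eq_sym => /andP[].
have a13 : ~~ adj u1 u3.
  by rewrite adjE // nx1 nx3 eq_sym negb_or n23 h1r.
have L1 : L u1.
  apply: contraNT a02 => L1; apply: clique => //.
    by apply: contraTT a01 => L0; apply: indep.
  by apply: contraTT a12 => L2; apply: indep.
have L3 : ~~ L u3 by apply: contra a13 => L3; apply: clique.
have L2 : L u2 by apply: contraTT a23 => L2; apply: indep.
have L0 : ~~ L u0 by apply: contra a02 => L0; apply: clique.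
case: r @c uc adjE u0c u1c u2c u3c n0r n1r n2r n3r ur nx0 nx1 nx2 nx3 h1r =>
    [|u4 r] c uc adjE u0c u1c u2c u3c.
  move=> _ _ _ _ _ _ _ _ nx3 _; have /negP := indep _ _ L3 L0; apply.
  by rewrite adjE // nx3 eqxx.
rewrite !inE !negb_or => /andP[n04 _] /andP[n14 _] /andP[n24 n2r] /andP[n34 _].
move=> _ _ _ nx2 nx3 _.
have u4c : u4 \in c by rewrite !inE eqxx !orbT.
have a34 : adj u3 u4 by rewrite adjE // nx3 eqxx.
have L4 : L u4 by apply: contraTT a34 => L4; apply: indep.
have nx4 : next c u4 = head u0 r.
  rewrite /next /= [u4 == u0]eq_sym [u4 == u1]eq_sym [u4 == u2]eq_sym [u4 == u3]eq_sym.
  rewrite (negPf n04) (negPf n14) (negPf n24) (negPf n34).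
  by case: (r) => [|? ?] /=; rewrite eqxx.
have := clique _ _ L2 L4 n24; rewrite adjE // nx2 nx4.
rewrite eq_sym (negPf n34) /=; case: (r) n2r => [|u5 r'] /=.
  by rewrite eq_sym (negPf n02).
by rewrite inE negb_or => /andP[/negPf->].
Qed.

Lemma whiskered_cochordal s (a : 'I_s -> nat) : cochordal (whiskered_complete a).
Proof.
pose L (v : complement (whiskered_complete a)) := if v is inr _ then true else false.
apply: (@split_graph_chordal _ L).
  case=> [i|w] // [j|w'] // _ _.
  by rewrite /adj /= /cadj /= negbK (inj_eq inl_inj) negb_and !negbK orbN.
by case=> [i|w] // [j|w'] // _ _ ne; rewrite /adj /= /cadj /= ne.
Qed.

(** * Depth of the squarefree powers *)

Section WhiskeredDepth.
Variables (K : fieldType) (s : nat) (a : 'I_s -> nat).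
Hypothesis a_gt0 : forall i, (0 < a i)%N.
Local Notation G := (whiskered_complete a).
Local Notation n := #|vertex G|.
Local Notation S := {mpoly K[n]}.
Local Notation hub i := (inl i : G).
Local Notation leaf w := (inr w : G).
Local Notation whisk i := (leaf (whisker a_gt0 i)).

Lemma card_leaves : (s <= #|~: (enum_rank @: [set hub i | i in 'I_s])|)%N.
Proof.
pose f i : 'I_n := enum_rank (whisk i).
have f_inj : injective f by move=> i j /enum_rank_inj [].
rewrite -[leqLHS](card_ord s) -(card_image f_inj); apply: subset_leq_card.
apply/subsetP => _ /imageP[i _ ->]; rewrite inE.
by apply/negP => /imsetP[_ /imsetP[j _ ->] /enum_rank_inj].
Qed.

(** The hubs are split first. Each branch either inverts 2k hubs, which already
    contain a k-matching, or kills some hub i. In the second case its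
    whisker y is a cone point: it may be inverted at no cost, and every set with a
    k-matching that contains y has more than 2k elements. *)
Lemma depth_seq_few_edges k : (0 < k)%N -> (2 * k <= s)%N ->
  depth_seq (squarefree_power (K := K) (G := G) k) (2 * k).
Proof.
move=> k0 ks; rewrite squarefree_powerE; set N := matched k.
have upN : up_closed N by apply: matched_up_closed.
apply: depth_seq_esym => //; first exact: matched0.
rewrite -(support_ideal_ext K (@colon_add0 _ N)).
pose X := enum_rank @: [set hub i | i in 'I_s].
apply: (@colon_add_partition _ _ _ _ X upN) => A B AB dAB.
pose T := [set i : 'I_s | enum_rank (hub i) \in A].
have [le_T|lt_T] := leqP (2 * k) #|T|.
  apply: weakly_regular_full => h m _; apply/orP; left.
  apply: (upN _ _ (subsetUl _ _)); apply: (@whiskered_has_matching _ _ _ T set0).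
  - exact: sub0set.
  - by move=> i; rewrite !inE.
  - by move=> i; rewrite inE.
  - by rewrite cards0.
have [i iT] : exists i, i \notin T.
  apply/existsP; apply: contraTT lt_T; rewrite negb_exists => /forallP allT.
  rewrite -leqNgt; suff -> : T = setT by rewrite cardsT card_ord.
  by apply/setP => i; rewrite in_setT; have := allT i; rewrite negbK.
have XB : B \subset X by rewrite -AB subsetUr.
have iB : enum_rank (hub i) \in B.
  have : enum_rank (hub i) \in X by rewrite !imset_f.
  by move: iT; rewrite inE -AB inE => /negbTE->.
pose y : 'I_n := enum_rank (whisk i).
have yX : y \notin X by apply/negP => /imsetP[_ /imsetP[j _ ->] /enum_rank_inj].
(* The hub of y is in B, so y lies in no edge outside B. *)
have cone (W : {set 'I_#|G|}) : W \subset ~: B -> N W -> N (W :\ y).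
  move=> sW NW; have /(has_matching_isolated (w := whisker a_gt0 i)) := NW.
  rewrite inE /=; have iW : enum_rank (hub i) \notin W.
    by apply: contraL iB => /(subsetP sW); rewrite inE.
  move=> /(_ iW); apply: has_matchingS; apply/subsetP => v; rewrite !inE => /andP[vy ->].
  by rewrite andbT (inj_eq enum_rank_inj).
rewrite (@support_ideal_ext _ _ _ (colon_add N (y |: A) B)); last first.
  move=> U; rewrite /colon_add; have [mU|mU] := boolP (meets B U); rewrite ?orbT // !orbF.
  apply/idP/idP; first by apply: upN; rewrite -setUA subsetUr.
  move=> NU; have sB : (y |: A) :|: U \subset ~: B.
    rewrite !subUset sub1set inE (contra (subsetP XB y) yX) /=.
    rewrite -disjoints_subset dAB; apply/subsetP => j jU; rewrite inE.
    by apply: contra mU => jB; apply/exists_inP; exists j.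
  apply: upN (cone _ sB NU); apply/subsetP => j; rewrite !inE.
  by case/andP=> /negbTE->.
apply: weakly_regular_esym => //.
- rewrite disjoints_subset subUset sub1set inE (contra (subsetP XB y) yX) /=.
  by rewrite -disjoints_subset.
- apply: leq_trans ks (leq_trans card_leaves (subset_leq_card _)).
  by rewrite setCS.
- move=> W sW sB NW; have := matched_card (cone W sB NW).
  rewrite (cardsD1 y W); suff -> : y \in W by rewrite add1n.
  by apply: (subsetP sW); rewrite setU11.
Qed.

(** The blocks are indexed by two copies of the hubs: inl i is the hub i alone,
    inr i is the set of all whiskers at i. *)
Definition block (v : 'I_n) : 'I_s + 'I_s :=
  match enum_val v with inl i => inl i | inr w => inr (tag w) end.

Definition block_weight (b : 'I_s + 'I_s) (v : 'I_n) : S := 'X_v * (block v == b)%:R.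

Definition representative (b : 'I_s + 'I_s) : 'I_n :=
  enum_rank (match b with inl i => hub i | inr i => whisk i end).

Lemma block_representative b : block (representative b) = b.
Proof. by rewrite /block /representative enum_rankK; case: b. Qed.

Definition blocks (q : seq 'I_s) : seq ('I_s + 'I_s) :=
  map inl (enum 'I_s) ++ map inr q.

Lemma size_blocks q : size (blocks q) = (s + size q)%N.
Proof. by rewrite size_cat !size_map -enumT size_enum_ord. Qed.

Lemma zip_block_weight bs (vs : seq 'I_n) : size vs = size bs ->
  \prod_(p <- zip (map block_weight bs) vs) p.1 p.2
   = (\prod_(v <- vs) 'X_v) * (map block vs == bs)%:R.
Proof.
elim: bs vs => [|b bs IH] [|v vs] //=; first by rewrite !big_nil mulr1.
move=> [sz]; rewrite !big_cons /= IH // /block_weight eqseq_cons.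
by case: eqP => _; case: eqP => _ /=; rewrite ?mulr1 ?mulr0 ?mul0r ?mulrA.
Qed.

Lemma mem_squarefree_power k (vs : seq 'I_n) (W : {set 'I_s}) :
  (forall i, inl i \in map block vs) ->
  (forall i, i \in W -> inr i \in map block vs) ->
  (2 * k <= #|W| + s)%N ->
  squarefree_power (K := K) (G := G) k (\prod_(v <- vs) 'X_v).
Proof.
move=> hubs leaves le_k; rewrite squarefree_powerE mprodXE.
apply/support_idealX.
have -> : mnm_supp (\sum_(v <- vs) U_(v))%MM = [set v in vs].
  elim: vs {hubs leaves} => [|v vs IH].
    by rewrite big_nil; apply/setP => i; rewrite !inE mnmE.
  rewrite big_cons mnm_suppD IH -mesym1_set1 mnm_supp_mesym1.
  by apply/setP => i; rewrite !inE.
have inU b : b \in map block vs -> exists2 v, block v = b & v \in vs.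
  by case/mapP=> v vvs ->; exists v.
apply: (@whiskered_has_matching _ _ _ setT W).
- exact: subsetT.
- move=> i _; have [v] := inU _ (hubs i); rewrite /block.
  by case e: (enum_val v) => [j|w] // [<-]; rewrite !inE -e enum_valK.
- move=> i /leaves /inU [v]; rewrite /block.
  case e: (enum_val v) => [j|w] // [<-] vvs; exists w => //.
  by rewrite !inE -e enum_valK.
- by rewrite cardsT card_ord.
Qed.

(** The cocycle is the product of the blocks given by all hubs and by the whiskers
    at 2k-1-s hubs. Multiplying it by one more whisker block b gives
    coefficients that contain all hubs and whiskers at 2k-s of them, hence
    a k-matching. *)
Lemma depth_seq_bound_many_edges k r : (k <= s)%N -> (s < 2 * k)%N ->
  depth_seq (squarefree_power (K := K) (G := G) k) r -> (r <= 2 * k - 1)%N.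
Proof.
move=> ks sk; set I := squarefree_power k.
have idI : is_ideal I by apply: squarefree_power_ideal.
(* j is nonnegative as s < 2k, and smaller than s as k <= s. *)
pose j := (2 * k - 1 - s)%N; pose q := take j (enum 'I_s).
have sq : size q = j by rewrite size_takel // size_enum_ord; lia.
have uq : uniq q by apply: take_uniq; apply: enum_uniq.
have sb : size (blocks q) = (2 * k - 1)%N by rewrite size_blocks sq; lia.
pose c := wedge_all (map block_weight (blocks q)).
apply: (@depth_seq_bound _ _ I (2 * k - 1) c) => //.
  move=> l _; rewrite (@wedge_weight_sum _ _ _ (enum {: 'I_s + 'I_s}) block_weight);
    last first.
    move=> v; rewrite big_enum /= (bigD1 (block v)) //= /block_weight eqxx mulr1.
    by rewrite big1 ?addr0 // => b; rewrite eq_sym => /negbTE->; rewrite mulr0.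
  apply: (ideal_sum idI) => b _.
  have [bq|bq] := boolP (b \in blocks q).
    by rewrite wedge_wedge_all //; apply: (ideal0 idI).
  case: b bq => i bq; first by rewrite mem_cat map_f ?mem_enum in bq.
  have := @wedge_all_ideal _ _ I 1 (map block_weight (inr i :: blocks q)) l idI.
  rewrite mul1r; apply=> vs; rewrite size_map mul1r => /zip_block_weight ->.
  have [e|_] := eqVneq; last by rewrite mulr0; apply: (ideal0 idI).
  rewrite mulr1; apply: (@mem_squarefree_power _ _ [set l in i :: q]).
  - by move=> l'; rewrite e inE mem_cat map_f ?mem_enum ?orbT.
  - move=> l'; rewrite e !inE mem_cat !(inj_eq inr_inj) => /orP[->//|l'q].
    by rewrite [X in _ || (_ || X)]map_f ?orbT.
  - rewrite cardsE (card_uniqP _) /= ?sq; first by lia.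
    rewrite uq andbT; apply: contra bq => iq.
    by rewrite mem_cat [X in _ || X]map_f ?orbT.
move=> [b cb].
have [i0 i0q] : exists i0, i0 \notin q.
  apply/existsP; rewrite -[X in is_true X]negbK negb_exists.
  apply/negP => /forallP allq.
  have : (s <= size q)%N.
    rewrite -[leqLHS](size_enum_ord s); apply: uniq_leq_size (enum_uniq _) _ => i _.
    by rewrite -[_ \in _]negbK; apply: allq.
  by rewrite sq; lia.
pose u := representative (inr i0); pose l := map representative (blocks q).
have bl : map block l = blocks q.
  by rewrite -map_comp map_id_in // => ? _; apply: block_representative.
have sl : size l = (2 * k - 1)%N by rewrite size_map.
have block0 b' v : block v != b' -> block_weight b' v = 0.
  by rewrite /block_weight => /negbTE->; rewrite mulr0.
have ubl : uniq (map block l).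
  rewrite bl cat_uniq (map_inj_uniq inl_inj) (map_inj_uniq inr_inj) enum_uniq uq andbT.
  by apply/hasPn => _ /mapP[i _ ->]; apply/negP => /mapP[].
have cu t : c (u :: t) = 0.
  apply: wedge_all_off; rewrite all_map; apply/allP => b' bq; apply/eqP/block0.
  rewrite block_representative; apply: contra i0q => /eqP e; move: bq; rewrite -e.
  by rewrite mem_cat => /orP[/mapP[]//|]; rewrite mem_map //; apply: inr_inj.
(* At a transversal u :: l of the blocks and one further whisker block, the
   differential of c is the product of the variables. *)
have dcE : wedge (fun i => 'X_i) c (u :: l) = 'X_[\sum_(v <- u :: l) U_(v)].
  rewrite /= wedge0 ?subr0 //.
  rewrite /c -bl wedge_all_diag // -mprodXE big_cons; congr (_ * _).
  by apply: eq_bigr => v _; rewrite /block_weight eqxx mulr1.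
suff /low_degreeX : low_degree (2 * k).+1 ('X_[\sum_(v <- u :: l) U_(v)] : S).
  rewrite mdeg_sum (eq_bigr (fun=> 1%N)) => [|v _]; last by rewrite mdeg1.
  by rewrite sum1_size /= sl; lia.
(* If c is the differential of b modulo I, then dc = d (c - db) has its
   coefficients in the maximal ideal times I. *)
pose x i : S := 'X_i.
have -> : 'X_[\sum_(v <- u :: l) U_(v)] = wedge x (fun t => c t - wedge x b t) (u :: l).
  by rewrite wedgeB wedge_wedge subr0 dcE.
apply: (wedge_mem (low_degree_ideal _ _ _)) => v t st; apply: low_degreeMX.
by apply: squarefree_power_low; apply: cb; move: st => /= [->].
Qed.

End WhiskeredDepth.

Theorem theorem3p6 (K : fieldType) (s : nat) (hs : (2 <= s)%N)
    (a : 'I_s -> nat) (ha : forall i, (1 <= a i)%N)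
    (k : nat) (hk : (1 <= k <= matching_number (whiskered_complete a))%N) :
  let G := whiskered_complete a in
  [/\ matching_number G = s,
      cochordal G &
      normalized_depth K G k = 0%R <-> (s %/ 2 + 1 <= k <= s)%N].
Proof.
move=> G; have nuG : matching_number G = s by apply: matching_number_whiskered.
move: hk; rewrite nuG => /andP[k0 ks].
split=> //; first exact: whiskered_cochordal.
set I := squarefree_power (K := K) (G := G) k.
have idI : is_ideal I by apply: squarefree_power_ideal.
have I1 f : I f -> low_degree 1 f.
  by move=> /squarefree_power_low low m /low; lia.
have [dI maxI] := is_depth_depth idI I1.
have zeroE : normalized_depth K G k = 0%R <-> depth I = (2 * k - 1)%N.
  by rewrite /normalized_depth -/I; split; lia.
rewrite ks andbT zeroE; split=> [e | le_k].
  rewrite leqNgt; apply/negP => lt_k.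
  have : (2 * k <= depth I)%N by apply/maxI/depth_seq_few_edges => //; lia.
  by rewrite e; lia.
apply/eqP; rewrite eqn_leq; apply/andP; split.
  by apply: (depth_seq_bound_many_edges ha ks) dI; lia.
apply/maxI/depth_seq_degree => //.
have := has_matching_card (whiskered_has_matching_max ha).
by rewrite cardsT; apply: leq_trans; lia.
Qed.
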